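(* Let $(N,g,\nabla)$ be a Weyl manifold of dimension $n\ge3$, with curvature tensor $R$ and conjugate curvature tensor $R^\star$. Then: (1) If $n=4$, then $\Lambda\operatorname{Ric}^\star=0$ and thus $\operatorname{Ric}^\star$ is symmetric. (2) If $n\ne4$, then $R^\star$ satisfies the relation $$R^\star_{ijlk}+R^\star_{ijkl}=\tfrac{4}{n-4}\,(\Lambda\operatorname{Ric}^\star)_{ij}\,g_{kl}.$$
   Context: A Weyl manifold is a triple $(N,g,\nabla)$ with $g$ a semi-Riemannian metric and $\nabla$ a torsion free connection on $TN$ such that $\nabla g=-2\phi\otimes g$ for some smooth $1$-form $\phi$. $\mathcal R(x,y)z:=(\nabla_x\nabla_y-\nabla_y\nabla_x-\nabla_{[x,y]})z$, $R(x,y,z,w):=g(\mathcal R(x,y)z,w)$. The conjugate curvature tensor is defined by $R^\star(x,y,w,z):=-R(x,y,z,w)$. $\operatorname{Ric}^\star(x,y):=g^{ij}R(x,e_i,e_j,y)$ (which equals $g^{ij}R^\star(e_i,x,y,e_j)$). For a $(0,2)$-tensor $\theta$, $\Lambda\theta$ is its anti-symmetrization, $(\Lambda\theta)_{ij}=\frac12(\theta_{ij}-\theta_{ji})$. Indices denote components in a local frame $\{e_i\}$, e.g. $R^\star_{ijkl}=R^\star(e_i,e_j,e_k,e_l)$. *)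

(* Defs.v *)
From HB Require Import structures.
From mathcomp Require Import all_boot all_order all_algebra.
From mathcomp Require Import all_classical all_reals all_analysis.

Set Implicit Arguments.
Unset Strict Implicit.
Unset Printing Implicit Defensive.
Import Order.TTheory GRing.Theory Num.Theory.
Import numFieldNormedType.Exports.

Local Open Scope classical_set_scope.
Local Open Scope ring_scope.

(* For an open set U of R^n: all partial derivatives of order at most k exist
   and are continuous on U. *)
Fixpoint Ck_on (R : realType) (n k : nat) (U : set 'rV[R]_n)
    (f : 'rV[R]_n -> R) {struct k} : Prop :=
  (forall x, U x -> {for x, continuous f}) /\
  match k with
  | 0 => True
  | k'.+1 => forall i : 'I_n,
      (forall x, U x -> derivable f x (delta_mx 0 i)) /\
      Ck_on k' U (fun x => 'D_(delta_mx 0 i) f x)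
  end.

Definition Cinfty_on (R : realType) (n : nat) (U : set 'rV[R]_n)
    (f : 'rV[R]_n -> R) : Prop := forall k, Ck_on k U f.

(* A homeomorphism from an open set of M onto an open set of R^n; [coord] and
   [param] are total functions whose values off [dom] and off
   [coord @` dom] are irrelevant. *)
Record chart (R : realType) (n : nat) (M : topologicalType) := Chart {
  dom : set M;
  coord : M -> 'rV[R]_n;
  param : 'rV[R]_n -> M;
  dom_open : open dom;
  codom_open : open (coord @` dom);
  coordK : forall p, dom p -> param (coord p) = p;
  coord_continuous : forall p, dom p -> {for p, continuous coord};
  param_continuous :
    forall x, (coord @` dom) x -> {for x, continuous param} }.

Record manifold (R : realType) (n : nat) := Manifold {
  space :> topologicalType;
  space_hausdorff : hausdorff_space space;
  space_second_countable : @second_countable space;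
  atlas : set (chart R n space);
  atlas_cover : forall p : space, exists2 c, atlas c & dom c p;
  atlas_smooth : forall c d, atlas c -> atlas d -> forall i : 'I_n,
    Cinfty_on (coord c @` (dom c `&` dom d))
      (fun x => coord d (param c x) 0 i) }.

Section Manifold.
Context (R : realType) (n : nat) (N : manifold R n).

Definition smooth_on (U : set N) (f : N -> R) : Prop :=
  forall c, atlas c -> Cinfty_on (coord c @` (U `&` dom c)) (f \o param c).

Definition smooth_at (p : N) (f : N -> R) : Prop :=
  exists U : set N, [/\ open U, U p & smooth_on U f].

(* Tangent vectors at p are the derivations of the algebra of germs at p of
   smooth functions.  All of them live in one vector space of functionals on
   N -> R: such a functional is only meaningful on functions smooth near p, and
   it is normalised to 0 on the others so that equality of functionals is
   equality of derivations. *)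
Definition functional : Type := (N -> R) -> R^o.

Definition tangent (p : N) (v : functional) : Prop :=
  [/\ forall f, ~ smooth_at p f -> v f = 0,
      forall f h, smooth_at p f -> smooth_at p h ->
        (\forall q \near p, f q = h q) -> v f = v h,
      forall (a : R) f h, smooth_at p f -> smooth_at p h ->
        v (fun q => a * f q + h q) = a * v f + v h
    & forall f h, smooth_at p f -> smooth_at p h ->
        v (fun q => f q * h q) = v f * h p + f p * v h].

Definition vfield : Type := N -> functional.

Definition smooth_vfield (U : set N) (X : vfield) : Prop :=
  (forall p, U p -> tangent p (X p)) /\
  (forall (V : set N) (f : N -> R), open V -> V `<=` U ->
     smooth_on V f -> smooth_on V (fun p => X p f)).

Definition lie (X Y : vfield) : vfield := fun p f =>
  if `[< smooth_at p f >]
  then X p (fun q => Y q f) - Y p (fun q => X q f) else 0.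

Definition is_basis (p : N) (m : nat) (b : 'I_m -> functional) : Prop :=
  (forall i, tangent p (b i)) /\
  (forall v, tangent p v ->
     exists! c : 'rV[R]_m, v = \sum_(i < m) c 0 i *: b i).

Definition local_frame (U : set N) (e : 'I_n -> vfield) : Prop :=
  (forall i, smooth_vfield U (e i)) /\
  (forall p, U p -> is_basis p (fun i => e i p)).

Definition form2 : Type := N -> functional -> functional -> R.

Definition negative_definite (g : form2) (p : N) (m : nat)
    (b : 'I_m -> functional) : Prop :=
  (forall i, tangent p (b i)) /\
  (forall c : 'rV[R]_m, c != 0 ->
     g p (\sum_(i < m) c 0 i *: b i) (\sum_(i < m) c 0 i *: b i) < 0).

(* nu is the largest dimension of a subspace of the tangent space at p on which
   g is negative definite; a family as in [negative_definite] is automatically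
   linearly independent. *)
Definition has_index (g : form2) (p : N) (nu : nat) : Prop :=
  (exists b : 'I_nu -> functional, negative_definite g p b) /\
  (forall (m : nat) (b : 'I_m -> functional),
     negative_definite g p b -> (m <= nu)%N).

Definition semi_riemannian (g : form2) : Prop :=
  [/\ forall p (a : R) u v w, tangent p u -> tangent p v -> tangent p w ->
        g p (a *: u + v) w = a * g p u w + g p v w,
      forall p u v, tangent p u -> tangent p v -> g p u v = g p v u,
      forall p u, tangent p u -> (forall v, tangent p v -> g p u v = 0) ->
        u = 0,
      forall (U : set N) X Y, open U -> smooth_vfield U X ->
        smooth_vfield U Y -> smooth_on U (fun p => g p (X p) (Y p))
    & exists nu : nat, forall p, has_index g p nu].

Definition form1 : Type := N -> functional -> R.

Definition smooth_form1 (phi : form1) : Prop :=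
  (forall p (a : R) u v, tangent p u -> tangent p v ->
     phi p (a *: u + v) = a * phi p u + phi p v) /\
  (forall (U : set N) X, open U -> smooth_vfield U X ->
     smooth_on U (fun p => phi p (X p))).

(* A connection acts on the smooth vector fields over each open set U (not only
   over N), compatibly with restriction; this is the second axiom, vector
   fields over U being represented by total functions. *)
Definition connection (nabla : vfield -> vfield -> vfield) : Prop :=
  forall U : set N, open U ->
  [/\ forall X Y, smooth_vfield U X -> smooth_vfield U Y ->
        smooth_vfield U (nabla X Y),
      forall X X' Y Y', smooth_vfield U X -> smooth_vfield U Y ->
        (forall p, U p -> X p = X' p) -> (forall p, U p -> Y p = Y' p) ->
        forall p, U p -> nabla X Y p = nabla X' Y' p,
      forall f X X' Y, smooth_on U f -> smooth_vfield U X ->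
        smooth_vfield U X' -> smooth_vfield U Y -> forall p, U p ->
        nabla (fun q => f q *: X q + X' q) Y p
        = f p *: nabla X Y p + nabla X' Y p,
      forall X Y Y', smooth_vfield U X -> smooth_vfield U Y ->
        smooth_vfield U Y' -> forall p, U p ->
        nabla X (fun q => Y q + Y' q) p = nabla X Y p + nabla X Y' p
    & forall f X Y, smooth_on U f -> smooth_vfield U X ->
        smooth_vfield U Y -> forall p, U p ->
        nabla X (fun q => f q *: Y q) p = X p f *: Y p + f p *: nabla X Y p].

Definition torsion_free (nabla : vfield -> vfield -> vfield) : Prop :=
  forall (U : set N) X Y, open U -> smooth_vfield U X -> smooth_vfield U Y ->
    forall p, U p -> nabla X Y p - nabla Y X p = lie X Y p.

(* (nabla_X g)(Y, Z) *)
Definition nabla_metric (nabla : vfield -> vfield -> vfield) (g : form2)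
    (X Y Z : vfield) (p : N) : R :=
  X p (fun q => g q (Y q) (Z q))
  - g p (nabla X Y p) (Z p) - g p (Y p) (nabla X Z p).

Definition weyl (g : form2) (nabla : vfield -> vfield -> vfield) : Prop :=
  [/\ semi_riemannian g, connection nabla, torsion_free nabla
    & exists2 phi : form1, smooth_form1 phi &
      forall (U : set N) X Y Z, open U -> smooth_vfield U X ->
        smooth_vfield U Y -> smooth_vfield U Z -> forall p, U p ->
        nabla_metric nabla g X Y Z p
        = - 2 * phi p (X p) * g p (Y p) (Z p)].

Section Curvature.
Variables (g : form2) (nabla : vfield -> vfield -> vfield).

Definition curv_op (X Y Z : vfield) : vfield := fun p =>
  nabla X (nabla Y Z) p - nabla Y (nabla X Z) p - nabla (lie X Y) Z p.

Definition curv (X Y Z W : vfield) (p : N) : R :=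
  g p (curv_op X Y Z p) (W p).

Definition conj_curv (X Y W Z : vfield) (p : N) : R := - curv X Y Z W p.

Definition gram (e : 'I_n -> vfield) (p : N) : 'M[R]_n :=
  \matrix_(i, j) g p (e i p) (e j p).

(* Ric^*, the trace being computed in the local frame e. *)
Definition ric_star (e : 'I_n -> vfield) (X Y : vfield) (p : N) : R :=
  \sum_(i < n) \sum_(j < n) invmx (gram e p) i j * curv X (e i) (e j) Y p.

End Curvature.

Definition alt (theta : vfield -> vfield -> N -> R) (X Y : vfield) (p : N) : R
  := 2^-1 * (theta X Y p - theta Y X p).

End Manifold.

(* Main.v *)
Require Import Defs.
From mathcomp Require Import all_boot all_order all_algebra.
From mathcomp Require Import all_classical all_reals all_analysis.
From mathcomp Require Import ring.
Import Order.TTheory GRing.Theory Num.Theory.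
Import numFieldNormedType.Exports.
Local Open Scope classical_set_scope.
Local Open Scope ring_scope.

(** Write phi for the one-form of the Weyl structure. Two identities govern the
    curvature of the connection.

    The first comes from differentiating the Weyl condition: applying
    X Y - Y X = [X, Y] to the function g(Z, W) gives
    R(X,Y,Z,W) + R(X,Y,W,Z) = 2 d phi(X,Y) g(Z,W)  ([curv_metric]).
    So the symmetric part of R in its last two arguments is a multiple of g,
    and the left-hand side of part (2) is -2 d phi(e_i,e_j) g(e_k,e_l).
    The second is the first Bianchi identity ([bianchi]), which for a
    torsion-free connection reduces to the Jacobi identity for the bracket.

    It remains to recover d phi from Ric^*. Moving the frame vector to the last
    slot with the first identity,
    Ric^*(X,Y) = 2 d phi(X,Y) - g^{ij} R(X,e_i,Y,e_j),
    and skew-symmetrizing with the second one,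
    Ric^*(X,Y) - Ric^*(Y,X) = 4 d phi(X,Y) - g^{ij} R(X,Y,e_i,e_j)
    = (4 - n) d phi(X,Y)  ([ric_star_skew]),
    because g^{ij} g_{ij} = n. In dimension 4 the right-hand side vanishes;
    otherwise one divides by 4 - n.

    The contraction g^{ij} d phi(X,e_i) g(e_j,Y) = d phi(X,Y) uses that d phi is
    linear over smooth functions. To avoid proving that quotients of smooth
    functions are smooth, the vector field expanded in the frame is
    det(g_{ij}) Y, whose coefficients are polynomial in smooth functions
    ([frame_expansion], [dform_frame]). *)

Set Implicit Arguments.
Unset Strict Implicit.

(** * Smooth functions form an algebra *)

Section Locality.
Variables (R : realType) (T : topologicalType).
Implicit Types (U : set T).

Lemma near_open U (P : T -> Prop) x : open U -> (forall y, U y -> P y) ->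
  U x -> \forall y \near x, P y.
Proof.
by move=> Uo UP Ux; apply: (filterS _ (open_nbhs_nbhs (conj Uo Ux))) => y /UP.
Qed.

Lemma continuous_at_eq_open U (f h : T -> R) x :
  open U -> (forall y, U y -> f y = h y) -> U x ->
  {for x, continuous f} -> {for x, continuous h}.
Proof.
move=> Uo fh Ux fx; rewrite /prop_for /continuous_at -(fh _ Ux).
apply: cvg_trans fx; apply: near_eq_cvg; exact: near_open fh Ux.
Qed.

End Locality.

Section Euclidean.
Variables (R : realType) (n : nat).
Implicit Types (U V : set 'rV[R]_n) (f h : 'rV[R]_n -> R).

Lemma Ck_on_sub k U V f : V `<=` U -> Ck_on k U f -> Ck_on k V f.
Proof.
move=> VU; elim: k f => [|k IH] f /= [fc fd].
  by split=> // x /VU/fc.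
split=> [x /VU/fc //|i].
by have [fi fk] := fd i; split=> [x /VU/fi //|]; exact: IH.
Qed.

(** Openness is what makes this true: differentiability at a point sees the
    values at all neighbouring points, so two functions that agree on an
    arbitrary set may have different derivatives there. *)
Lemma Ck_on_eq k U f h : open U -> (forall x, U x -> f x = h x) ->
  Ck_on k U f -> Ck_on k U h.
Proof.
move=> Uo; elim: k f h => [|k IH] f h fh [fc fd].
  by split=> // x Ux; apply: continuous_at_eq_open (fh) _ (fc x Ux).
have fhn x : U x -> \forall y \near x, f y = h y.
  exact: near_open.
split=> [x Ux|i].
  exact: continuous_at_eq_open Uo fh Ux (fc x Ux).
have [fi fk] := fd i; split=> [x Ux|].
  exact: near_eq_derivable (fhn _ Ux) (fi _ Ux).
by apply: IH fk => x Ux; apply: near_eq_derive; exact: fhn.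
Qed.

Lemma Ck_onW k U f : Ck_on k.+1 U f -> Ck_on k U f.
Proof.
elim: k f => [|k IH] f [fc fd]; first by split.
split=> // i.
by have [fi fk] := fd i; split=> //; exact: IH.
Qed.

Lemma Ck_on_cst k U (c : R) : open U -> Ck_on k U (fun=> c).
Proof.
move=> Uo; elim: k c => [|k IH] c.
  by split=> // x _; exact: cst_continuous.
split=> [x _|i]; first exact: cst_continuous.
split=> [x _|]; first exact: derivable_cst.
by apply: Ck_on_eq (IH 0) => // x _; rewrite derive_cst.
Qed.

Lemma Ck_onD k U f h : open U -> Ck_on k U f -> Ck_on k U h ->
  Ck_on k U (fun x => f x + h x).
Proof.
move=> Uo; elim: k f h => [|k IH] f h [fc fd] [hc hd].
  by split=> // x Ux; apply: continuousD; [exact: fc|exact: hc].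
split=> [x Ux|i]; first by apply: continuousD; [exact: fc|exact: hc].
have [fi fk] := fd i; have [hi hk] := hd i; split=> [x Ux|].
  by apply: derivableD; [exact: fi|exact: hi].
apply: Ck_on_eq (IH _ _ fk hk) => // x Ux.
by rewrite -deriveD //; [exact: fi|exact: hi].
Qed.

(** The derivative of a product involves the undifferentiated factors, so the
    induction must first weaken their regularity from k+1 to k. *)
Lemma Ck_onM k U f h : open U -> Ck_on k U f -> Ck_on k U h ->
  Ck_on k U (fun x => f x * h x).
Proof.
move=> Uo; elim: k f h => [|k IH] f h fk1 hk1.
all: have [fc fd] := fk1; have [hc hd] := hk1.
  by split=> // x Ux; apply: continuousM; [exact: fc|exact: hc].
split=> [x Ux|i]; first by apply: continuousM; [exact: fc|exact: hc].
have [fi fk] := fd i; have [hi hk] := hd i; split=> [x Ux|].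
  by apply: derivableM; [exact: fi|exact: hi].
apply: Ck_on_eq
  (Ck_onD Uo (IH _ _ (Ck_onW fk1) hk) (IH _ _ (Ck_onW hk1) fk)) => // x Ux.
by rewrite -[RHS]/('D__ (f * h) x) deriveM //; [exact: fi|exact: hi].
Qed.

End Euclidean.

Section SmoothFunctions.
Variables (R : realType) (n : nat) (N : manifold R n).
Implicit Types (U V : set N) (f h : N -> R).

Lemma open_coord_image (c : chart R n N) U :
  open U -> open (Defs.coord c @` (U `&` dom c)).
Proof.
move=> Uo; have -> : Defs.coord c @` (U `&` dom c) =
    (Defs.coord c @` dom c) `&` (param c @^-1` U).
  apply/seteqP; split=> [x [q [Uq cq] <-]|x [[q cq <-]]] /=.
    by split; [exists q|rewrite /= coordK].
  by rewrite coordK // => Uq; exists q.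
rewrite openE => x [cx Ux]; apply: filterI.
  by apply: open_nbhs_nbhs; split=> //; exact: codom_open.
exact: (param_continuous cx (open_nbhs_nbhs (conj Uo Ux))).
Qed.

Lemma smooth_on_sub U V f : V `<=` U -> smooth_on U f -> smooth_on V f.
Proof.
move=> VU fU c ac k; apply: Ck_on_sub (fU c ac k).
by apply: image_subset => q [/VU].
Qed.

Lemma smooth_on_eq U f h : open U -> (forall q, U q -> f q = h q) ->
  smooth_on U f -> smooth_on U h.
Proof.
move=> Uo fh fU c ac k; apply: Ck_on_eq (fU c ac k).
  exact: open_coord_image.
by move=> _ [q [Uq cq] <-] /=; rewrite coordK ?fh.
Qed.

Lemma smooth_on_cst U (a : R) : open U -> smooth_on U (fun=> a).
Proof. by move=> Uo c ac k; apply: Ck_on_cst; exact: open_coord_image. Qed.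

Lemma smooth_onD U f h : open U -> smooth_on U f -> smooth_on U h ->
  smooth_on U (fun q => f q + h q).
Proof.
move=> Uo fU hU c ac k; apply: (@Ck_onD _ _ _ _ (f \o param c) (h \o param c)).
- exact: open_coord_image.
- exact: fU.
- exact: hU.
Qed.

Lemma smooth_onM U f h : open U -> smooth_on U f -> smooth_on U h ->
  smooth_on U (fun q => f q * h q).
Proof.
move=> Uo fU hU c ac k; apply: (@Ck_onM _ _ _ _ (f \o param c) (h \o param c)).
- exact: open_coord_image.
- exact: fU.
- exact: hU.
Qed.

Lemma smooth_on_sum U (I : Type) (s : seq I) (P : pred I) (F : I -> N -> R) :
  open U -> (forall i, smooth_on U (F i)) ->
  smooth_on U (fun q => \sum_(i <- s | P i) F i q).
Proof.
move=> Uo FU; elim: s => [|i s IH].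
  apply: smooth_on_eq (smooth_on_cst 0 Uo) => // q _; by rewrite big_nil.
have [Pi|nPi] := boolP (P i).
  apply: smooth_on_eq (smooth_onD Uo (FU i) IH) => // q _.
  by rewrite big_cons Pi.
by apply: smooth_on_eq IH => // q _; rewrite big_cons (negPf nPi).
Qed.

Lemma smooth_on_prod U (I : Type) (s : seq I) (P : pred I) (F : I -> N -> R) :
  open U -> (forall i, smooth_on U (F i)) ->
  smooth_on U (fun q => \prod_(i <- s | P i) F i q).
Proof.
move=> Uo FU; elim: s => [|i s IH].
  apply: smooth_on_eq (smooth_on_cst 1 Uo) => // q _; by rewrite big_nil.
have [Pi|nPi] := boolP (P i).
  apply: smooth_on_eq (smooth_onM Uo (FU i) IH) => // q _.
  by rewrite big_cons Pi.
by apply: smooth_on_eq IH => // q _; rewrite big_cons (negPf nPi).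
Qed.

Lemma smooth_on_det U m (A : N -> 'M[R]_m) : open U ->
  (forall i j, smooth_on U (fun q => A q i j)) ->
  smooth_on U (fun q => \det (A q)).
Proof.
move=> Uo AU; apply: smooth_on_sum => // s.
apply: smooth_onM => //; first exact: smooth_on_cst.
exact: smooth_on_prod.
Qed.

(** The entries of the adjugate are polynomials in those of the matrix. This
    replaces smoothness of the inverse matrix, which would require that the
    reciprocal of a smooth function be smooth. *)
Lemma smooth_on_adj U m (A : N -> 'M[R]_m) : open U ->
  (forall i j, smooth_on U (fun q => A q i j)) ->
  forall i j, smooth_on U (fun q => \adj (A q) i j).
Proof.
move=> Uo AU i j.
apply: (@smooth_on_eq _ (fun q => cofactor (A q) j i)) => // [q _|].
  by rewrite mxE.
apply: smooth_onM => //; first exact: smooth_on_cst.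
apply: smooth_on_det => // k l.
by apply: smooth_on_eq (AU (lift j k) (lift i l)) => // q _; rewrite !mxE.
Qed.

Lemma smooth_at_on U f (p : N) :
  open U -> U p -> smooth_on U f -> smooth_at p f.
Proof. by move=> Uo Up fU; exists U. Qed.

Lemma smooth_at_common (p : N) f h : smooth_at p f -> smooth_at p h ->
  exists U, [/\ open U, U p, smooth_on U f & smooth_on U h].
Proof.
move=> [U [Uo Up fU]] [V [Vo Vp hV]]; exists (U `&` V); split=> //.
- exact: openI.
- by apply: smooth_on_sub fU => q [].
- by apply: smooth_on_sub hV => q [].
Qed.

Lemma smooth_at_cst (p : N) (a : R) : smooth_at p (fun=> a).
Proof.
exists setT; split=> //; first exact: openT.
exact: smooth_on_cst openT.
Qed.

Lemma smooth_atD (p : N) f h : smooth_at p f -> smooth_at p h ->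
  smooth_at p (fun q => f q + h q).
Proof.
move=> fp /(smooth_at_common fp)[U [Uo Up fU hU]].
by exists U; split=> //; exact: smooth_onD.
Qed.

Lemma smooth_atM (p : N) f h : smooth_at p f -> smooth_at p h ->
  smooth_at p (fun q => f q * h q).
Proof.
move=> fp /(smooth_at_common fp)[U [Uo Up fU hU]].
by exists U; split=> //; exact: smooth_onM.
Qed.

Lemma smooth_at_near (p : N) f :
  smooth_at p f -> \forall q \near p, smooth_at q f.
Proof.
move=> [U [Uo Up fU]].
by apply: (near_open Uo _ Up) => q Uq; exists U; split.
Qed.

Lemma smooth_at_eq (p : N) f h : (\forall q \near p, f q = h q) ->
  smooth_at p f -> smooth_at p h.
Proof.
rewrite /prop_near1 nbhsE => -[V [Vo Vp] VE] [U [Uo Up fU]].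
exists (U `&` V); split=> //; first exact: openI.
apply: (@smooth_on_eq _ f); first exact: openI.
  by move=> q [_ /VE].
by apply: smooth_on_sub fU => q [].
Qed.

End SmoothFunctions.

(** * Tangent vectors and vector fields *)

Section Tangent.
Variables (R : realType) (n : nat) (N : manifold R n).
Implicit Types (f h : N -> R) (p : N) (u v w : functional N).

Lemma addfnE u v f : (u + v) f = u f + v f. Proof. by []. Qed.
Lemma oppfnE u f : (- u) f = - u f. Proof. by []. Qed.
Lemma scalefnE (a : R) u f : (a *: u) f = a * u f. Proof. by []. Qed.

(** The definition asks for smoothness of both functions; the second follows
    from the first, since smoothness at a point depends only on the germ. *)
Lemma tangent_near p v f h : tangent p v -> smooth_at p f ->
  (\forall q \near p, f q = h q) -> v f = v h.
Proof.
move=> [_ vl _ _] fp fh; apply: vl => //; exact: smooth_at_eq fh fp.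
Qed.

Lemma tangent_lin p v (a : R) f h : tangent p v -> smooth_at p f ->
  smooth_at p h -> v (fun q => a * f q + h q) = a * v f + v h.
Proof. by case=> _ _ H _; exact: H. Qed.

Lemma tangent_mul p v f h : tangent p v -> smooth_at p f ->
  smooth_at p h -> v (fun q => f q * h q) = v f * h p + f p * v h.
Proof. by case=> _ _ _ H; exact: H. Qed.

Lemma tangent_cst p v (a : R) : tangent p v -> v (fun=> a) = 0.
Proof.
move=> vp.
have v0 : v (fun=> 0) = 0.
  have := tangent_lin 1 vp (smooth_at_cst p 0) (smooth_at_cst p 0).
  have -> : (fun _ : N => 1 * 0 + 0 : R) = fun=> 0.
    by apply/funext => q; rewrite mulr0 addr0.
  by rewrite mul1r => /esym/eqP; rewrite -subr_eq0 addrK => /eqP.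
have v1 : v (fun=> 1) = 0.
  have := tangent_mul vp (smooth_at_cst p 1) (smooth_at_cst p 1).
  have -> : (fun _ : N => 1 * 1 : R) = fun=> 1.
    by apply/funext => q; rewrite mulr1.
  by rewrite mulr1 mul1r => /esym/eqP; rewrite -subr_eq0 addrK => /eqP.
have := tangent_lin a vp (smooth_at_cst p 1) (smooth_at_cst p 0).
have -> : (fun _ : N => a * 1 + 0 : R) = fun=> a.
  by apply/funext => q; rewrite mulr1 addr0.
by rewrite v0 v1 mulr0 addr0.
Qed.

Lemma tangent_add p v f h : tangent p v -> smooth_at p f ->
  smooth_at p h -> v (fun q => f q + h q) = v f + v h.
Proof.
move=> vp fp hp; rewrite -[v f]mul1r -(tangent_lin 1 vp fp hp).
by congr v; apply/funext => q; rewrite mul1r.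
Qed.

Lemma tangent_scale p v (a : R) f : tangent p v -> smooth_at p f ->
  v (fun q => a * f q) = a * v f.
Proof.
move=> vp fp; rewrite (tangent_mul vp (smooth_at_cst p a) fp).
by rewrite (tangent_cst a vp) mul0r add0r.
Qed.

Lemma smooth_atN p f : smooth_at p f -> smooth_at p (fun q => - f q).
Proof.
move=> fp; have := smooth_atM (smooth_at_cst p (-1)) fp.
apply: smooth_at_eq; near=> q; by rewrite mulN1r.
Unshelve. all: by end_near. Qed.

Lemma tangent_opp p v f : tangent p v -> smooth_at p f ->
  v (fun q => - f q) = - v f.
Proof.
move=> vp fp; rewrite -mulN1r -(tangent_scale _ vp fp).
by congr v; apply/funext => q; rewrite mulN1r.
Qed.

Lemma tangent_sub p v f h : tangent p v -> smooth_at p f ->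
  smooth_at p h -> v (fun q => f q - h q) = v f - v h.
Proof.
move=> vp fp hp.
by rewrite (tangent_add vp fp (smooth_atN hp)) (tangent_opp vp).
Qed.

Lemma tangent0 p : tangent p 0.
Proof.
split=> //; first by move=> a f h _ _ /=; rewrite mulr0 addr0.
by move=> f h _ _ /=; rewrite mulr0 mul0r addr0.
Qed.

Lemma tangentD p u v : tangent p u -> tangent p v -> tangent p (u + v).
Proof.
move=> up vp; split.
- move=> f nf; case: up vp => [H _ _ _] [H' _ _ _].
  by rewrite addfnE H // H' // addr0.
- move=> f h fp hp fh.
  by rewrite !addfnE (tangent_near up fp fh) (tangent_near vp fp fh).
- move=> a f h fp hp; rewrite !addfnE !(tangent_lin a _ fp hp) //.
  by rewrite mulrDr addrACA.
- move=> f h fp hp; rewrite !addfnE !(tangent_mul _ fp hp) //.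
  by rewrite mulrDr mulrDl addrACA.
Qed.

Lemma tangentZ p (a : R) u : tangent p u -> tangent p (a *: u).
Proof.
move=> up; split.
- by move=> f nf; case: up => [H _ _ _]; rewrite scalefnE H ?mulr0.
- by move=> f h fp hp fh; rewrite !scalefnE (tangent_near up fp fh).
- move=> b f h fp hp; rewrite !scalefnE (tangent_lin b up fp hp).
  by rewrite mulrDr mulrCA.
- move=> f h fp hp; rewrite !scalefnE (tangent_mul up fp hp).
  by ring.
Qed.

Lemma tangentN p u : tangent p u -> tangent p (- u).
Proof. by move=> up; rewrite -scaleN1r; exact: tangentZ. Qed.

Lemma tangent_sum p (I : Type) (s : seq I) (P : pred I)
    (F : I -> functional N) :
  (forall i, tangent p (F i)) -> tangent p (\sum_(i <- s | P i) F i).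
Proof.
move=> Fp; elim/big_rec: _ => [|i v _ vp]; first exact: tangent0.
exact: tangentD.
Qed.

End Tangent.

Section VectorFields.
Variables (R : realType) (n : nat) (N : manifold R n).
Implicit Types (f h : N -> R) (p : N) (X Y Z : vfield N).

Section OnOpen.
Variables (U : set N) (Uo : open U).

Lemma smooth_at_app X p f : smooth_vfield U X -> U p -> smooth_at p f ->
  smooth_at p (fun q => X q f).
Proof.
move=> [_ XU] Up [V [Vo Vp fV]].
exists (U `&` V); split=> //; first exact: openI.
apply: XU; [exact: openI|by move=> q []|].
by apply: smooth_on_sub fV => q [].
Qed.

Lemma smooth_vfield_eq X Y : (forall q, U q -> X q = Y q) ->
  smooth_vfield U X -> smooth_vfield U Y.
Proof.
move=> XY [Xt Xs]; split=> [p Up|V f Vo VU fV].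
  by rewrite -XY //; exact: Xt.
by apply: smooth_on_eq (Xs V f Vo VU fV) => // q /VU Uq; rewrite XY.
Qed.

Lemma smooth_vfieldD X Y : smooth_vfield U X -> smooth_vfield U Y ->
  smooth_vfield U (fun q => X q + Y q).
Proof.
move=> [Xt Xs] [Yt Ys]; split=> [p Up|V f Vo VU fV].
  by apply: tangentD; [exact: Xt|exact: Yt].
by apply: smooth_onD => //; [exact: Xs|exact: Ys].
Qed.

Lemma smooth_vfieldZ h X : smooth_on U h -> smooth_vfield U X ->
  smooth_vfield U (fun q => h q *: X q).
Proof.
move=> hU [Xt Xs]; split=> [p Up|V f Vo VU fV].
  by apply: tangentZ; exact: Xt.
by apply: smooth_onM => //; [exact: smooth_on_sub VU hU|exact: Xs].
Qed.

Lemma smooth_vfield0 : smooth_vfield U (fun=> 0).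
Proof.
split=> [p Up|V f Vo VU fV]; first exact: tangent0.
exact: smooth_on_cst.
Qed.

Lemma smooth_vfield_sum (I : Type) (s : seq I) (F : I -> vfield N) :
  (forall i, smooth_vfield U (F i)) ->
  smooth_vfield U (fun q => \sum_(i <- s) F i q).
Proof.
move=> FU; elim: s => [|i s IH].
  by apply: smooth_vfield_eq smooth_vfield0 => q _; rewrite big_nil.
by apply: smooth_vfield_eq (smooth_vfieldD (FU i) IH) => q _; rewrite big_cons.
Qed.

Lemma lie_smoothE X Y p f : smooth_at p f ->
  lie X Y p f = X p (fun q => Y q f) - Y p (fun q => X q f).
Proof. by move=> fp; rewrite /lie asboolT. Qed.

(** The derivative of a germ along a field is again a germ: near p, the
    functions agree not only at each q but on a neighbourhood of it. *)
Lemma near_app X p f h : smooth_vfield U X -> U p -> smooth_at p f ->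
  (\forall q \near p, f q = h q) -> \forall q \near p, X q f = X q h.
Proof.
move=> [Xt _] Up fp fh.
have fq := smooth_at_near fp.
have fhq : \forall q \near p, \forall r \near q, f r = h r.
  exact: (nbhs_interior fh).
have Uq : \forall q \near p, U q := open_nbhs_nbhs (conj Uo Up).
near=> q; apply: (@tangent_near _ _ _ q); first by apply: Xt; near: q.
  by near: q.
by near: q.
Unshelve. all: by end_near. Qed.

(** The commutator of derivations is a derivation because the mixed terms
    X f * Y h and Y f * X h cancel. Rewriting under the outer derivation is
    legitimate only near p, hence the auxiliary facts stated for q near p. *)
Lemma tangent_lie X Y p : smooth_vfield U X -> smooth_vfield U Y -> U p ->
  tangent p (lie X Y p).
Proof.
move=> XU YU Up; have Xp := XU.1 p Up; have Yp := YU.1 p Up.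
have Xs f (fp : smooth_at p f) := smooth_at_app XU Up fp.
have Ys f (fp : smooth_at p f) := smooth_at_app YU Up fp.
have Uq : \forall q \near p, U q := open_nbhs_nbhs (conj Uo Up).
split.
- by move=> f nf; rewrite /lie asboolF.
- move=> f h fp hp fh; rewrite !lie_smoothE //.
  rewrite (tangent_near Xp (Ys _ fp) (near_app YU Up fp fh)).
  by rewrite (tangent_near Yp (Xs _ fp) (near_app XU Up fp fh)).
- move=> a f h fp hp; rewrite !lie_smoothE //; last first.
    by apply: smooth_atD => //; apply: smooth_atM => //; exact: smooth_at_cst.
  have lin Z : smooth_vfield U Z -> \forall q \near p,
      a * Z q f + Z q h = Z q (fun q => a * f q + h q).
    move=> ZU; have fq := smooth_at_near fp; have hq := smooth_at_near hp.
    near=> q; rewrite (@tangent_lin _ _ _ q) //; last by near: q.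
      by apply: ZU.1; near: q.
    by near: q.
  have sm Z : smooth_vfield U Z -> smooth_at p (fun q => a * Z q f + Z q h).
    move=> ZU; apply: smooth_atD; last exact: smooth_at_app ZU Up hp.
    by apply: smooth_atM; [exact: smooth_at_cst|exact: smooth_at_app ZU Up fp].
  rewrite -(tangent_near Xp (sm _ YU) (lin _ YU)).
  rewrite -(tangent_near Yp (sm _ XU) (lin _ XU)).
  rewrite (tangent_lin a Xp (Ys _ fp) (Ys _ hp)).
  rewrite (tangent_lin a Yp (Xs _ fp) (Xs _ hp)).
  by ring.
- move=> f h fp hp; rewrite !lie_smoothE //; last exact: smooth_atM.
  have lei Z : smooth_vfield U Z -> \forall q \near p,
      Z q f * h q + f q * Z q h = Z q (fun q => f q * h q).
    move=> ZU; have fq := smooth_at_near fp; have hq := smooth_at_near hp.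
    near=> q; rewrite (@tangent_mul _ _ _ q) //; last by near: q.
      by apply: ZU.1; near: q.
    by near: q.
  have sm Z : smooth_vfield U Z ->
      smooth_at p (fun q => Z q f * h q) /\ smooth_at p (fun q => f q * Z q h).
    by move=> ZU; split; apply: smooth_atM => //; exact: smooth_at_app ZU Up _.
  have [sY1 sY2] := sm _ YU; have [sX1 sX2] := sm _ XU.
  rewrite -(tangent_near Xp (smooth_atD sY1 sY2) (lei _ YU)).
  rewrite -(tangent_near Yp (smooth_atD sX1 sX2) (lei _ XU)).
  rewrite (tangent_add Xp sY1 sY2) (tangent_add Yp sX1 sX2).
  rewrite !(tangent_mul Xp) ?(tangent_mul Yp) //; try by [exact: Xs|exact: Ys].
  by ring.
Unshelve. all: by end_near. Qed.

Lemma smooth_lie X Y : smooth_vfield U X -> smooth_vfield U Y ->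
  smooth_vfield U (lie X Y).
Proof.
move=> XU YU; split=> [p Up|V f Vo VU fV]; first exact: tangent_lie.
have YV : smooth_on V (fun q => Y q f) by apply: YU.2.
have XV : smooth_on V (fun q => X q f) by apply: XU.2.
apply: (@smooth_on_eq _ _ _ _
  (fun p => X p (fun q => Y q f) + -1 * Y p (fun q => X q f))) => //.
  by move=> p Vp; rewrite mulN1r lie_smoothE //; exact: smooth_at_on Vp fV.
apply: smooth_onD => //; first exact: XU.2.
by apply: smooth_onM => //; [exact: smooth_on_cst|exact: YU.2].
Qed.

Lemma lieNC X Y : lie X Y = fun q => - lie Y X q.
Proof.
apply/funext => q; apply/funext => f; rewrite oppfnE /lie.
by case: ifP => _; rewrite ?oppr0 ?opprB.
Qed.

(** Commutators in an associative algebra satisfy the Jacobi identity: after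
    expansion, each of the six third-order derivatives of f occurs twice,
    with opposite signs. *)
Lemma jacobi X Y Z p : smooth_vfield U X -> smooth_vfield U Y ->
  smooth_vfield U Z -> U p ->
  lie X (lie Y Z) p + lie Y (lie Z X) p + lie Z (lie X Y) p = 0.
Proof.
move=> XU YU ZU Up; apply/funext => f; rewrite !addfnE.
have [fp|nf] := pselect (smooth_at p f); last first.
  by rewrite /lie asboolF // !addr0.
have lieE A B C : smooth_vfield U A -> smooth_vfield U B -> smooth_vfield U C ->
    C p (fun q => lie A B q f) =
    C p (fun q => A q (fun r => B r f)) - C p (fun q => B q (fun r => A r f)).
  move=> AU BU CU.
  have sB := smooth_at_app AU Up (smooth_at_app BU Up fp).
  have sA := smooth_at_app BU Up (smooth_at_app AU Up fp).
  have Cp := CU.1 p Up.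
  rewrite -(tangent_sub Cp sB sA); apply/esym/(tangent_near Cp).
    by apply: smooth_atD => //; exact: smooth_atN.
  have fq := smooth_at_near fp.
  by near=> q; rewrite lie_smoothE //; near: q.
rewrite !lie_smoothE; try by [exact: fp|exact: smooth_at_app Up fp].
rewrite !lieE // [RHS](_ : _ = 0 :> R) //.
ring.
Unshelve. all: by end_near. Qed.

Lemma lieDr X Y Z p : smooth_vfield U X -> smooth_vfield U Y ->
  smooth_vfield U Z -> U p ->
  lie X (fun q => Y q + Z q) p = lie X Y p + lie X Z p.
Proof.
move=> XU YU ZU Up; apply/funext => f; rewrite !addfnE.
have [fp|nf] := pselect (smooth_at p f); last first.
  by rewrite /lie asboolF // !addr0.
rewrite !lie_smoothE; try by [exact: fp|exact: smooth_at_app Up fp].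
rewrite (tangent_add (f := Y^~ f) (h := Z^~ f) (XU.1 p Up)); first last.
  exact: smooth_at_app ZU Up fp.
  exact: smooth_at_app YU Up fp.
rewrite addfnE; by ring.
Qed.

Lemma lieZr X Y h p : smooth_vfield U X -> smooth_vfield U Y ->
  smooth_on U h -> U p ->
  lie X (fun q => h q *: Y q) p = h p *: lie X Y p + X p h *: Y p.
Proof.
move=> XU YU hU Up; apply/funext => f; rewrite !addfnE !scalefnE.
have [fp|nf] := pselect (smooth_at p f); last first.
  rewrite /lie asboolF // mulr0 add0r.
  by case: (YU.1 p Up) => -> //; rewrite mulr0.
rewrite !lie_smoothE // (tangent_mul (f := h) (h := Y^~ f) (XU.1 p Up)).
- by rewrite scalefnE; ring.
- exact: smooth_at_on Up hU.
- exact: smooth_at_app YU Up fp.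
Qed.

End OnOpen.
End VectorFields.

(** * The metric in a local frame *)

Section Weyl.
Variables (R : realType) (n : nat) (N : manifold R n).
Variables (g : form2 N) (nabla : vfield N -> vfield N -> vfield N).
Variable phi : form1 N.
Implicit Types (X Y Z W : vfield N) (p : N) (u v w : functional N).

Section Metric.
Hypothesis g_riem : semi_riemannian g.

Lemma metricDl p u v w : tangent p u -> tangent p v -> tangent p w ->
  g p (u + v) w = g p u w + g p v w.
Proof.
move=> up vp wp; case: g_riem => gl _ _ _ _.
by rewrite -[u in LHS]scale1r gl // mul1r.
Qed.

Lemma metric0l p w : tangent p w -> g p 0 w = 0.
Proof.
move=> wp; have := metricDl (tangent0 p) (tangent0 p) wp.
by rewrite addr0 => /esym/eqP; rewrite -subr_eq0 addrK => /eqP.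
Qed.

Lemma metricZl p (a : R) u w : tangent p u -> tangent p w ->
  g p (a *: u) w = a * g p u w.
Proof.
move=> up wp; case: g_riem => gl _ _ _ _.
by rewrite -[a *: u]addr0 gl ?metric0l ?addr0 //; exact: tangent0.
Qed.

Lemma metricBl p u v w : tangent p u -> tangent p v -> tangent p w ->
  g p (u - v) w = g p u w - g p v w.
Proof.
move=> up vp wp; rewrite metricDl //; last exact: tangentN.
by rewrite -scaleN1r metricZl // mulN1r.
Qed.

Lemma metricC p u v : tangent p u -> tangent p v -> g p u v = g p v u.
Proof. by case: g_riem => _ gC _ _ _; exact: gC. Qed.

Lemma metric_suml p m (c : 'I_m -> R) (b : 'I_m -> functional N) w :
  (forall i, tangent p (b i)) -> tangent p w ->
  g p (\sum_i c i *: b i) w = \sum_i c i * g p (b i) w.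
Proof.
move=> bp wp.
suff [] : tangent p (\sum_i c i *: b i) /\
  g p (\sum_i c i *: b i) w = \sum_i c i * g p (b i) w by [].
elim/big_rec2: _ => [|i x v _ [vp <-]].
  by split; [exact: tangent0|exact: metric0l].
split; first by apply: tangentD => //; exact: tangentZ.
by rewrite metricDl ?metricZl //; exact: tangentZ.
Qed.

Lemma smooth_metric U X Y : open U -> smooth_vfield U X -> smooth_vfield U Y ->
  smooth_on U (fun p => g p (X p) (Y p)).
Proof. by case: g_riem => _ _ _ gs _; exact: gs. Qed.

Variables (U : set N) (e : 'I_n -> vfield N) (p : N).
Hypotheses (e_frame : local_frame U e) (Up : U p).

Lemma gram_sym : (gram g e p)^T = gram g e p.
Proof.
by apply/matrixP => i j; rewrite !mxE metricC //; apply: (e_frame.1 _).1.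
Qed.

(** A vector of coefficients killed by the Gram matrix gives a tangent vector
    orthogonal to a basis, hence zero by nondegeneracy; the uniqueness of
    coordinates in a basis then kills the coefficients. *)
Lemma gram_unit : gram g e p \in unitmx.
Proof.
have ep i : tangent p (e i p) by apply: (e_frame.1 i).1.
rewrite -row_free_unit -kermx_eq0; apply/rowV0P => c /sub_kermxP cG.
have [_ bas] := e_frame.2 p Up.
case: g_riem => _ _ nondeg _ _.
have v0 : \sum_(i < n) c 0 i *: e i p = 0.
  apply: nondeg; first by apply: tangent_sum => i; exact: tangentZ.
  move=> v vp; have [d [vE _]] := bas v vp.
  have tc : tangent p (\sum_(i < n) c 0 i *: e i p).
    by apply: tangent_sum => i; exact: tangentZ.
  rewrite metricC // vE metric_suml // big1 // => j _.
  rewrite metricC // metric_suml //.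
  transitivity (d 0 j * (c *m gram g e p) 0 j); last by rewrite cG mxE mulr0.
  by rewrite mxE; congr (_ * _); apply: eq_bigr => i _; rewrite mxE.
have [d [_ dU]] := bas 0 (tangent0 p).
rewrite -(dU c) ?v0 // (dU 0) //.
by rewrite big1 // => i _; rewrite mxE scale0r.
Qed.

(** Cramer's rule without division. Multiplying by the determinant keeps the
    coefficients of the expansion visibly smooth in p. *)
Lemma frame_expansion v : tangent p v ->
  \det (gram g e p) *: v =
  \sum_i (\sum_j \adj (gram g e p) i j * g p (e j p) v) *: e i p.
Proof.
move=> vp; have ep i : tangent p (e i p) by apply: (e_frame.1 i).1.
have [_ bas] := e_frame.2 p Up.
have [c [-> _]] := bas v vp.
rewrite scaler_sumr; apply: eq_bigr => i _; rewrite scalerA; congr (_ *: _).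
transitivity (((\det (gram g e p))%:M *m c^T) i 0).
  by rewrite mul_scalar_mx !mxE.
rewrite -mul_adj_mx -mulmxA mxE; apply: eq_bigr => j _; congr (_ * _).
have tc : tangent p (\sum_(i < n) c 0 i *: e i p).
  by apply: tangent_sum => k; exact: tangentZ.
rewrite metricC // metric_suml // mxE; apply: eq_bigr => k _.
by rewrite !mxE mulrC metricC.
Qed.

End Metric.

(** * The exterior derivative of a one-form *)

Section OneForm.
Hypothesis phi_smooth : smooth_form1 phi.

Lemma form1D p u v : tangent p u -> tangent p v ->
  phi p (u + v) = phi p u + phi p v.
Proof.
by move=> up vp; rewrite -[u in LHS]scale1r phi_smooth.1 // mul1r.
Qed.

Lemma form1_0 p : phi p 0 = 0.
Proof.
have := form1D (tangent0 p) (tangent0 p).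
by rewrite addr0 => /esym/eqP; rewrite -subr_eq0 addrK => /eqP.
Qed.

Lemma form1Z p (a : R) u : tangent p u -> phi p (a *: u) = a * phi p u.
Proof.
by move=> up; rewrite -[a *: u]addr0 phi_smooth.1 ?form1_0 ?addr0 //;
  exact: tangent0.
Qed.

(** The exterior derivative, by its invariant formula; no factor 1/2. *)
Definition dform X Y p : R :=
  X p (fun q => phi q (Y q)) - Y p (fun q => phi q (X q)) - phi p (lie X Y p).

Variables (U : set N) (Uo : open U).

Lemma smooth_at_form1 X p : smooth_vfield U X -> U p ->
  smooth_at p (fun q => phi q (X q)).
Proof. by move=> XU Up; exists U; split=> //; exact: phi_smooth.2. Qed.

Lemma lie_eqr X Y Y' p : smooth_vfield U X -> smooth_vfield U Y ->
  (forall q, U q -> Y q = Y' q) -> U p -> lie X Y p = lie X Y' p.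
Proof.
move=> XU YU YY' Up; apply/funext => f.
have [fp|nf] := pselect (smooth_at p f); last by rewrite /lie asboolF.
rewrite !lie_smoothE // YY' //; congr (_ - _).
apply: (tangent_near (XU.1 p Up)); first exact: smooth_at_app YU Up fp.
by apply: (near_open Uo _ Up) => q Uq; rewrite YY'.
Qed.

Lemma dform_eqr X Y Y' p : smooth_vfield U X -> smooth_vfield U Y ->
  (forall q, U q -> Y q = Y' q) -> U p -> dform X Y p = dform X Y' p.
Proof.
move=> XU YU YY' Up; rewrite /dform -(lie_eqr XU YU YY' Up) -(YY' p Up).
congr (_ - _ - _); apply: (tangent_near (XU.1 p Up)).
  exact: smooth_at_form1.
by apply: (near_open Uo _ Up) => q Uq; rewrite YY'.
Qed.

Lemma dformDr X Y Z p : smooth_vfield U X -> smooth_vfield U Y ->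
  smooth_vfield U Z -> U p ->
  dform X (fun q => Y q + Z q) p = dform X Y p + dform X Z p.
Proof.
move=> XU YU ZU Up; rewrite /dform (lieDr Uo XU YU ZU Up) addfnE form1D.
- rewrite -(tangent_near (f := fun q => phi q (Y q) + phi q (Z q)) (XU.1 p Up)).
  + rewrite (tangent_add (XU.1 p Up)); try exact: smooth_at_form1.
    by ring.
  + by apply: smooth_atD; exact: smooth_at_form1.
  + by apply: (near_open Uo _ Up) => q Uq; rewrite form1D //;
      [exact: YU.1|exact: ZU.1].
- exact: tangent_lie XU YU Up.
- exact: tangent_lie XU ZU Up.
Qed.

(** In X (h phi(Y)) the term (X h) phi(Y) is cancelled by the one that the Lie
    bracket with h Y produces: this is why the combination is a tensor although
    none of its three terms is. *)
Lemma dformZr X Y h p : smooth_vfield U X -> smooth_vfield U Y ->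
  smooth_on U h -> U p ->
  dform X (fun q => h q *: Y q) p = h p * dform X Y p.
Proof.
move=> XU YU hU Up; rewrite /dform (lieZr Uo XU YU hU Up) scalefnE.
have tl := tangent_lie Uo XU YU Up; have tY := YU.1 p Up.
have hp := smooth_at_on Uo Up hU.
rewrite form1D; [|exact: tangentZ..]; rewrite !form1Z //.
rewrite -(tangent_near (f := fun q => h q * phi q (Y q)) (XU.1 p Up)).
- rewrite (tangent_mul (XU.1 p Up)) //; last exact: smooth_at_form1.
  by ring.
- by apply: smooth_atM => //; exact: smooth_at_form1.
- by apply: (near_open Uo _ Up) => q Uq; rewrite form1Z //; exact: YU.1.
Qed.

Lemma dform_sumr X (I : Type) (s : seq I) (a : I -> N -> R)
    (e : I -> vfield N) p : smooth_vfield U X ->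
  (forall i, smooth_vfield U (e i)) -> (forall i, smooth_on U (a i)) -> U p ->
  dform X (fun q => \sum_(i <- s) a i q *: e i q) p =
  \sum_(i <- s) a i p * dform X (e i) p.
Proof.
move=> XU eU aU Up.
have aeU i : smooth_vfield U (fun q => a i q *: e i q) by exact: smooth_vfieldZ.
elim: s => [|i s IH].
  rewrite big_nil; have s0 := smooth_vfield0 U.
  have c0 := smooth_on_cst 0 Uo.
  rewrite -(dform_eqr XU (smooth_vfieldZ c0 s0)) //.
    by rewrite (dformZr XU s0 c0 Up) mul0r.
  by move=> q _; rewrite big_nil scaler0.
rewrite big_cons -IH -dformZr // -dformDr //; last exact: smooth_vfield_sum.
apply/esym/(dform_eqr XU) => //; last by move=> q _; rewrite big_cons.
by apply: smooth_vfieldD => //; exact: smooth_vfield_sum.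
Qed.

Lemma dformNC X Y p : smooth_vfield U X -> smooth_vfield U Y -> U p ->
  dform X Y p = - dform Y X p.
Proof.
move=> XU YU Up; rewrite /dform.
have -> : lie X Y p = -1 *: lie Y X p by rewrite lieNC scaleN1r.
rewrite form1Z.
  by ring.
exact: tangent_lie YU XU Up.
Qed.

End OneForm.

(** * Curvature of a Weyl connection *)

Hypothesis weyl_g : semi_riemannian g.
Hypothesis nabla_conn : connection nabla.
Hypothesis nabla_tf : torsion_free nabla.
Hypothesis phi_smooth : smooth_form1 phi.
Hypothesis nabla_g : forall (U : set N) X Y Z, open U -> smooth_vfield U X ->
  smooth_vfield U Y -> smooth_vfield U Z -> forall p, U p ->
  nabla_metric nabla g X Y Z p = - 2 * phi p (X p) * g p (Y p) (Z p).

Variables (U : set N) (Uo : open U).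

Lemma smooth_nabla X Y : smooth_vfield U X -> smooth_vfield U Y ->
  smooth_vfield U (nabla X Y).
Proof. by case: (nabla_conn Uo) => H _ _ _ _; exact: H. Qed.

Lemma nablaNl X Y p : smooth_vfield U X -> smooth_vfield U Y -> U p ->
  nabla (fun q => - X q) Y p = - nabla X Y p.
Proof.
move=> XU YU Up; case: (nabla_conn Uo) => _ loc lin _ _.
have s0 := smooth_vfield0 U.
have sN : smooth_vfield U (fun q => - X q).
  apply: smooth_vfield_eq (smooth_vfieldZ (smooth_on_cst (-1) Uo) XU) => //.
  by move=> q _; rewrite scaleN1r.
have n0 : nabla (fun=> 0) Y p = 0.
  have := lin (fun=> 1) _ _ _ (smooth_on_cst 1 Uo) s0 s0 YU p Up.
  rewrite -(loc (fun=> 0) _ Y Y) //; last by move=> q _; rewrite scaler0 addr0.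
  by rewrite scale1r => /esym/eqP; rewrite -subr_eq0 addrK => /eqP.
have := lin (fun=> -1) _ _ _ (smooth_on_cst (-1) Uo) XU s0 YU p Up.
rewrite -(loc (fun q => - X q) _ Y Y) //.
  by rewrite n0 addr0 scaleN1r.
by move=> q _; rewrite addr0 scaleN1r.
Qed.

Lemma nabla_torsion X Y p : smooth_vfield U X -> smooth_vfield U Y -> U p ->
  nabla X Y p = nabla Y X p + lie X Y p.
Proof. by move=> XU YU Up; rewrite -(nabla_tf Uo XU YU Up) addrC subrK. Qed.

(** Absence of torsion, differentiated once more. *)
Lemma nabla2_torsion X Y Z p : smooth_vfield U X -> smooth_vfield U Y ->
  smooth_vfield U Z -> U p ->
  nabla X (nabla Y Z) p = nabla X (nabla Z Y) p + nabla X (lie Y Z) p.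
Proof.
move=> XU YU ZU Up; case: (nabla_conn Uo) => _ loc _ add _.
rewrite -add //; [|exact: smooth_nabla|exact: smooth_lie].
apply: loc => //; first exact: smooth_nabla.
by move=> q Uq; exact: nabla_torsion.
Qed.

Lemma tangent_curv_op X Y Z p : smooth_vfield U X -> smooth_vfield U Y ->
  smooth_vfield U Z -> U p -> tangent p (curv_op nabla X Y Z p).
Proof.
move=> XU YU ZU Up; rewrite /curv_op.
have sm A B : smooth_vfield U A -> smooth_vfield U B -> tangent p (nabla A B p).
  by move=> AU BU; apply: (smooth_nabla AU BU).1.
apply: tangentD; last by apply: tangentN; apply: sm => //; exact: smooth_lie.
by apply: tangentD; [|apply: tangentN]; apply: sm => //; exact: smooth_nabla.
Qed.

Lemma curv_opNC X Y Z p : smooth_vfield U X -> smooth_vfield U Y ->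
  smooth_vfield U Z -> U p ->
  curv_op nabla X Y Z p = - curv_op nabla Y X Z p.
Proof.
move=> XU YU ZU Up; rewrite /curv_op (lieNC X Y) nablaNl //; last first.
  exact: smooth_lie.
by rewrite !opprB opprK addrC.
Qed.

(** Exchanging the two inner arguments of each second derivative, and then the
    two arguments of each derivative along a bracket, leaves only the three
    double brackets, whose sum vanishes by the Jacobi identity. *)
Lemma bianchi X Y Z p : smooth_vfield U X -> smooth_vfield U Y ->
  smooth_vfield U Z -> U p ->
  curv_op nabla X Y Z p + curv_op nabla Y Z X p + curv_op nabla Z X Y p = 0.
Proof.
move=> XU YU ZU Up; rewrite /curv_op.
rewrite (nabla2_torsion XU YU ZU Up) (nabla2_torsion YU ZU XU Up).
rewrite (nabla2_torsion ZU XU YU Up).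
rewrite (nabla_torsion XU (smooth_lie Uo YU ZU) Up).
rewrite (nabla_torsion YU (smooth_lie Uo ZU XU) Up).
rewrite (nabla_torsion ZU (smooth_lie Uo XU YU) Up).
rewrite -[RHS](jacobi Uo XU YU ZU Up).
apply/funext => f; rewrite !addfnE !oppfnE.
by ring.
Qed.

Lemma metric_derivative X Y Z p : smooth_vfield U X -> smooth_vfield U Y ->
  smooth_vfield U Z -> U p ->
  X p (fun q => g q (Y q) (Z q)) =
  g p (nabla X Y p) (Z p) + g p (Y p) (nabla X Z p)
  + - 2 * (phi p (X p) * g p (Y p) (Z p)).
Proof.
move=> XU YU ZU Up; have := nabla_g Uo XU YU ZU Up.
by rewrite /nabla_metric mulrA => <-; ring.
Qed.

(** The second derivatives of the function g(Z, W), in a form where only first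
    derivatives of functions g(_, _) remain to be evaluated. *)
Lemma metric_derivative2 X Y Z W p : smooth_vfield U X -> smooth_vfield U Y ->
  smooth_vfield U Z -> smooth_vfield U W -> U p ->
  X p (fun q => Y q (fun r => g r (Z r) (W r))) =
  X p (fun q => g q (nabla Y Z q) (W q))
  + X p (fun q => g q (Z q) (nabla Y W q))
  + - 2 * (X p (fun q => phi q (Y q)) * g p (Z p) (W p)
           + phi p (Y p) * X p (fun q => g q (Z q) (W q))).
Proof.
move=> XU YU ZU WU Up; have Xp := XU.1 p Up.
have sm A B : smooth_vfield U A -> smooth_vfield U B ->
    smooth_at p (fun q => g q (A q) (B q)).
  by move=> AU BU; apply: (smooth_at_on Uo Up); exact: smooth_metric.
have s1 := sm _ _ (smooth_nabla YU ZU) WU.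
have s2 := sm _ _ ZU (smooth_nabla YU WU).
have s3 := sm _ _ ZU WU.
have sphi := smooth_at_form1 phi_smooth Uo YU Up.
have s4 := smooth_atM sphi s3.
have s5 := smooth_atM (smooth_at_cst p (-2)) s4.
rewrite -(tangent_mul Xp sphi s3) -(tangent_scale _ Xp s4).
rewrite -(tangent_add Xp s1 s2) -(tangent_add Xp (smooth_atD s1 s2) s5).
apply/esym/(tangent_near Xp); first exact: smooth_atD (smooth_atD s1 s2) s5.
by apply: (near_open Uo _ Up) => q Uq; rewrite metric_derivative.
Qed.

(** A metric connection has curvature skew in its last two arguments. For a
    Weyl connection the defect is measured by d phi: apply the commutator
    identity X Y - Y X = [X, Y] to the function g(Z, W) and expand. The terms
    where X and Y hit different arguments of g, or where one of them hits
    g(Z, W) and the other is fed to phi, are symmetric in X and Y and drop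
    out. *)
Lemma curv_metric X Y Z W p : smooth_vfield U X -> smooth_vfield U Y ->
  smooth_vfield U Z -> smooth_vfield U W -> U p ->
  curv g nabla X Y Z W p + curv g nabla X Y W Z p =
  2 * dform X Y p * g p (Z p) (W p).
Proof.
move=> XU YU ZU WU Up.
have XYU := smooth_lie Uo XU YU.
have tg A : smooth_vfield U A -> tangent p (A p) by move=> AU; exact: AU.1.
have gC A B : smooth_vfield U A -> smooth_vfield U B ->
    g p (A p) (B p) = g p (B p) (A p).
  by move=> AU BU; apply: metricC => //; exact: tg.
have sn A B AU BU := @smooth_nabla A B AU BU.
have curvE A B : smooth_vfield U A -> smooth_vfield U B ->
    curv g nabla X Y A B p = g p (nabla X (nabla Y A) p) (B p)
      - g p (nabla Y (nabla X A) p) (B p) - g p (nabla (lie X Y) A p) (B p).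
  move=> AU BU; have t1 := tg _ (sn _ _ XU (sn _ _ YU AU)).
  have t2 := tg _ (sn _ _ YU (sn _ _ XU AU)); have t3 := tg _ (sn _ _ XYU AU).
  rewrite /curv /curv_op !metricBl //; try exact: tg.
  by apply: tangentD => //; exact: tangentN.
have hp : smooth_at p (fun q => g q (Z q) (W q)).
  by apply: (smooth_at_on Uo Up); exact: smooth_metric.
have := lie_smoothE X Y hp.
rewrite (metric_derivative XYU ZU WU Up).
rewrite (metric_derivative2 XU YU ZU WU Up) (metric_derivative2 YU XU ZU WU Up).
rewrite (metric_derivative XU ZU WU Up) (metric_derivative YU ZU WU Up).
rewrite (metric_derivative XU (sn _ _ YU ZU) WU Up).
rewrite (metric_derivative XU ZU (sn _ _ YU WU) Up).
rewrite (metric_derivative YU (sn _ _ XU ZU) WU Up).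
rewrite (metric_derivative YU ZU (sn _ _ XU WU) Up).
rewrite !curvE // /dform.
rewrite (gC _ _ (sn _ _ XU (sn _ _ YU WU)) ZU).
rewrite (gC _ _ (sn _ _ YU (sn _ _ XU WU)) ZU).
rewrite (gC _ _ (sn _ _ XYU WU) ZU).
move=> H; apply/eqP; rewrite -subr_eq0; apply/eqP.
move/eqP: H; rewrite -subr_eq0 => /eqP H.
rewrite -[RHS]oppr0 -H; ring.
Qed.

(** * Contraction in a frame *)

Variable e : 'I_n -> vfield N.
Hypothesis e_frame : local_frame U e.

(** This is d phi(X, Y) with Y expanded in the frame. Tensoriality of the
    two-form is applied to det(gram) Y, whose frame coefficients are smooth,
    and the nonzero value of the determinant at p is cancelled afterwards. *)
Lemma dform_frame X Y p : smooth_vfield U X -> smooth_vfield U Y -> U p ->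
  \sum_i \sum_j invmx (gram g e p) i j * (dform X (e i) p * g p (e j p) (Y p))
  = dform X Y p.
Proof.
move=> XU YU Up; have eU i := e_frame.1 i.
have gU i j : smooth_on U (fun q => gram g e q i j).
  apply: (@smooth_on_eq _ _ _ _ (fun q => g q (e i q) (e j q))) => //.
    by move=> q _; rewrite mxE.
  exact: smooth_metric.
have DU := smooth_on_det Uo gU.
pose a i q := \sum_j \adj (gram g e q) i j * g q (e j q) (Y q).
have aU i : smooth_on U (a i).
  apply: smooth_on_sum => // j; apply: smooth_onM => //.
    exact: smooth_on_adj.
  exact: smooth_metric.
have Gu := gram_unit weyl_g e_frame Up.
have D0 : \det (gram g e p) != 0 by rewrite -unitfE -unitmxE.
apply: (mulfI D0); rewrite -(dformZr phi_smooth Uo XU YU DU Up).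
rewrite (dform_eqr (Y' := fun q => \sum_i a i q *: e i q) phi_smooth Uo XU) //.
- rewrite (dform_sumr phi_smooth Uo _ XU eU aU Up) mulr_sumr.
  apply: eq_bigr => i _; rewrite mulr_sumr mulr_suml; apply: eq_bigr => j _.
  rewrite /invmx Gu mxE !mulrA mulfV // mul1r.
  by rewrite -!mulrA; congr (_ * _); rewrite mulrC.
- exact: smooth_vfieldZ.
- by move=> q Uq; rewrite (frame_expansion weyl_g e_frame Uq) //; exact: YU.1.
Qed.

Lemma trace_sym (A : 'M[R]_n) (K : 'I_n -> 'I_n -> R) : A^T = A ->
  \sum_i \sum_j A i j * K i j = \sum_i \sum_j A i j * K j i.
Proof.
move=> At; rewrite exchange_big; apply: eq_bigr => i _; apply: eq_bigr => j _.
by rewrite -[in LHS]At mxE.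
Qed.

(** The inverse Gram matrix is symmetric, so only the symmetric part of the
    curvature in its last two arguments contributes; by the Weyl condition that
    part is d phi(X, Y) g, and the trace of g is n. *)
Lemma trace_curv X Y p : smooth_vfield U X -> smooth_vfield U Y -> U p ->
  \sum_i \sum_j invmx (gram g e p) i j * curv g nabla X Y (e i) (e j) p
  = n%:R * dform X Y p.
Proof.
move=> XU YU Up; have eU i := e_frame.1 i.
set G := gram g e p; have Gu : G \in unitmx := gram_unit weyl_g e_frame Up.
have Gt : G^T = G := gram_sym weyl_g e_frame Up.
have Gi : (invmx G)^T = invmx G by rewrite trmx_inv Gt.
set S := LHS; have S2 : S + S = 2 * (n%:R * dform X Y p).
  rewrite {2}/S (trace_sym _ Gi) -big_split /=.
  under eq_bigr => i _ do rewrite -big_split /=.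
  transitivity (2 * dform X Y p * \tr (invmx G *m G)).
    rewrite /mxtrace mulr_sumr; apply: eq_bigr => i _.
    rewrite mxE mulr_sumr; apply: eq_bigr => j _.
    rewrite -mulrDr (curv_metric XU YU (eU i) (eU j) Up).
    by rewrite -[in G j i]Gt !mxE mulrCA.
  by rewrite mulVmx // mxtrace1; ring.
by apply: (@mulfI _ 2); [rewrite pnatr_eq0|rewrite -S2; ring].
Qed.

Lemma ric_star_expand X Y p : smooth_vfield U X -> smooth_vfield U Y -> U p ->
  ric_star g nabla e X Y p = 2 * dform X Y p
  - \sum_i \sum_j invmx (gram g e p) i j * curv g nabla X (e i) Y (e j) p.
Proof.
move=> XU YU Up; have eU i := e_frame.1 i.
rewrite -(dform_frame XU YU Up) mulr_sumr -sumrB; apply: eq_bigr => i _.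
rewrite mulr_sumr -sumrB; apply: eq_bigr => j _.
rewrite -[curv g nabla X (e i) (e j) Y p]
  (addrK (curv g nabla X (e i) Y (e j) p)).
by rewrite (curv_metric XU (eU i) (eU j) YU Up); ring.
Qed.

(** The skew part of Ric^* collects 2 d phi(X, Y) from each of the two orders
    of the arguments and, through the Bianchi identity, minus the trace of the
    endomorphism R(X, Y), which is n d phi(X, Y). The dimension 4 is exactly
    where these contributions cancel. *)
Lemma ric_star_skew X Y p : smooth_vfield U X -> smooth_vfield U Y -> U p ->
  ric_star g nabla e X Y p - ric_star g nabla e Y X p =
  (4 - n%:R) * dform X Y p.
Proof.
move=> XU YU Up; have eU i := e_frame.1 i.
rewrite !ric_star_expand // (dformNC phi_smooth Uo YU XU Up).
rewrite mulrBl -(trace_curv XU YU Up).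
set A := \sum_i _; set B := \sum_i _; set C := \sum_i _.
(* A and B are what is left of Ric^*(X, Y) and Ric^*(Y, X), and C is the trace
   of R(X, Y). *)
suff -> : C = A - B by ring.
rewrite /A /B /C -sumrB; apply: eq_bigr => i _.
rewrite -sumrB; apply: eq_bigr => j _; rewrite -mulrBr; congr (_ * _).
have tc A1 A2 A3 (s1 : smooth_vfield U A1) s2 s3 :=
  @tangent_curv_op A1 A2 A3 p s1 s2 s3 Up.
have ej : tangent p (e j p) by apply: (eU j).1.
rewrite /curv -metricBl; [|exact: weyl_g|exact: tc|exact: tc|exact: ej].
congr (g p _ _).
have := bianchi XU (eU i) YU Up.
rewrite (curv_opNC (eU i) YU XU Up) (curv_opNC YU XU (eU i) Up).
by move/eqP; rewrite subr_eq0 => /eqP ->.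
Qed.

End Weyl.

Theorem proposition1p5 (R : realType) (n : nat) (N : manifold R n)
    (g : form2 N) (nabla : vfield N -> vfield N -> vfield N)
    (hn : (3 <= n)%N) (hW : weyl g nabla) :
  (n = 4%N ->
     forall (U : set N) (e : 'I_n -> vfield N), open U -> local_frame U e ->
     forall X Y : vfield N, smooth_vfield U X -> smooth_vfield U Y ->
     forall p : N, U p ->
       alt (ric_star g nabla e) X Y p = 0 /\
       ric_star g nabla e X Y p = ric_star g nabla e Y X p) /\
  (n <> 4%N ->
     forall (U : set N) (e : 'I_n -> vfield N), open U -> local_frame U e ->
     forall p : N, U p -> forall i j k l : 'I_n,
       conj_curv g nabla (e i) (e j) (e l) (e k) p
       + conj_curv g nabla (e i) (e j) (e k) (e l) p
       = 4 / (n%:R - 4) * alt (ric_star g nabla e) (e i) (e j) p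
         * g p (e k p) (e l p)).
Proof.
have [g_riem conn tf [phi phi_smooth nabla_g]] := hW.
have skew := ric_star_skew g_riem conn tf phi_smooth nabla_g.
split=> [n4|n4] U e Uo e_frame.
  move=> X Y XU YU p Up.
  have symm : ric_star g nabla e X Y p = ric_star g nabla e Y X p.
    apply/eqP; rewrite -subr_eq0 (skew _ Uo _ e_frame _ _ _ XU YU Up).
    by have -> : n%:R = 4 :> R by [rewrite n4]; rewrite subrr mul0r.
  by split=> //; rewrite /alt symm subrr mulr0.
move=> p Up i j k l; have eU m := e_frame.1 m.
have n4R : n%:R - 4 != 0 :> R by rewrite subr_eq0 eqr_nat; apply/eqP.
rewrite /alt (skew _ Uo _ e_frame _ _ _ (eU i) (eU j) Up) /conj_curv -opprD.
rewrite (curv_metric g_riem conn phi_smooth nabla_g Uo) //.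
by field.
Qed.
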